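(* Let $n \ge 1$, let $m \ge 0$, let $(Q_1,\dots,Q_m)$ be a random tuple (with an arbitrary joint distribution) of ideals in the subspace lattice of $(\mathbb{F}_2)^n$, and let $f : \{0,1\}^m \to (\mathbb{F}_2)^n \setminus \{\vec 0\}$ be a function. Suppose that for every nonzero subspace $A$ of $(\mathbb{F}_2)^n$, \[ \Pr_{Q_1,\dots,Q_m}\big[\, f(1_{\{A \in Q_1\}},\dots,1_{\{A \in Q_m\}}) \in A \,\big] \ge 1/2, \] where $1_{\{A \in Q_i\}}$ is the indicator of the event $A \in Q_i$. Then $m = \Omega(n^2)$; that is, there are absolute constants $c>0$ and $n_0$ such that whenever $n \ge n_0$ and the hypothesis holds, $m \ge c n^2$.
   Context: The subspace lattice of $(\mathbb{F}_2)^n$ is the set of all linear subspaces of $(\mathbb{F}_2)^n$ ordered by inclusion. An ideal in it is a downward-closed set of subspaces: if $A$ belongs to it and $B \subseteq A$ is a subspace, then $B$ belongs to it. *)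

(* Defs.v *)
From HB Require Import structures.
From mathcomp Require Import all_boot all_order all_algebra.
Set Implicit Arguments. Unset Strict Implicit. Unset Printing Implicit Defensive.
Import Order.TTheory GRing.Theory Num.Theory.
Local Open Scope ring_scope.

Notation vecF2 n := 'rV['F_2]_n.

Definition is_subspace (n : nat) (S : {set vecF2 n}) : bool :=
  (0 \in S) &&
  [forall x in S, forall y in S, forall a : 'F_2, (a *: x + y) \in S].

Definition is_ideal (n : nat) (Q : {set {set vecF2 n}}) : bool :=
  [forall A in Q, is_subspace A] &&
  [forall A in Q, forall B : {set vecF2 n},
     (is_subspace B && (B \subset A)) ==> (B \in Q)].

Definition tupleT (n m : nat) := {ffun 'I_m -> {set {set vecF2 n}}}.

Definition is_ideal_tuple_distr (R : realFieldType) (n m : nat)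
  (mu : tupleT n m -> R) : Prop :=
  (forall q, 0 <= mu q) /\ (\sum_q mu q = 1) /\
  (forall q, mu q != 0 -> forall i, is_ideal (q i)).

Definition prob_hit (R : realFieldType) (n m : nat) (mu : tupleT n m -> R)
  (f : {ffun 'I_m -> bool} -> vecF2 n) (A : {set vecF2 n}) : R :=
  \sum_(q : tupleT n m | f [ffun i => A \in q i] \in A) mu q.

(* Main.v *)
Require Import Defs.
From HB Require Import structures.
From mathcomp Require Import all_boot all_order all_algebra.
From mathcomp Require Import ring lra zify.
Set Implicit Arguments. Unset Strict Implicit. Unset Printing Implicit Defensive.
Import Order.TTheory GRing.Theory Num.Theory.
Local Open Scope ring_scope.

(** By averaging (Yao), it suffices to bound, for each fixed tuple of ideals, the
    success probability against a random subspace A: the row space of a uniform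
    k x n matrix, with k uniform in 1..K and K of order n.

    For an ideal Q let p_k be the probability that A is in Q.  Rossman's
    threshold inequality says that the odds (1 - p_k) / p_k at least double from
    k to k + 1, i.e. p_(k+1) (2 - p_k) <= p_k.  Hence there is a level t at which
    the answer to the query Q flips, and the minority answer at level k has
    probability O(2^-|k-t|).  Giving a minority answer the cost |k-t|, both the
    expected cost of an answer vector and the sum of 2^-|k-t| over the m queries
    are O(m / K) for an average k.  Since there are at most 2^L prod_i (1 + 2^-c_i)
    answer vectors of cost below L, the guess takes only 2^O(L + m / n) values up
    to a small error, whereas a fixed nonzero vector lies in A with probability at
    most 2^(k-n).  This forces m / n to be at least of order n.

    The threshold inequality is proved by Fourier analysis over F_2.  Let v be the
    indicator of "row space of M in Q" on (k+1) x n matrices, with mean nu.  A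
    nontrivial character S has average 2^-rank(S) <= 1/2 over the matrices y x
    with y a random column and x a random row, so
    E[v(M) v(M + y x)] <= (nu^2 + nu) / 2.  For fixed y != 0, this expectation is
    at least nu^2 / p_k by Cauchy-Schwarz, as the shift by y x fixes a uniform
    k x n part of M whose row space is in Q whenever that of M is; and for y = 0
    it is nu. *)

(** * Uniform averages over finite types *)

Definition avg (R : realFieldType) (T : finType) (F : T -> R) : R :=
  (\sum_x F x) / #|T|%:R.

Section Average.
Variables (R : realFieldType) (T : finType).
Implicit Types F G : T -> R.

Lemma eq_avg F G : F =1 G -> avg F = avg G.
Proof. by move=> FG; rewrite /avg (eq_bigr G). Qed.

Lemma avgD F G : avg (fun x => F x + G x) = avg F + avg G.
Proof. by rewrite /avg big_split mulrDl. Qed.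

Lemma avgZ c F : avg (fun x => c * F x) = c * avg F.
Proof. by rewrite /avg -mulr_sumr mulrA. Qed.

Lemma avg_sum (I : finType) (P : pred I) (F : I -> T -> R) :
  avg (fun x => \sum_(i | P i) F i x) = \sum_(i | P i) avg (F i).
Proof. by rewrite /avg exchange_big mulr_suml. Qed.

Lemma ler_avg F G : (forall x, F x <= G x) -> avg F <= avg G.
Proof. by move=> FG; rewrite ler_wpM2r ?invr_ge0 ?ler0n // ler_sum. Qed.

Lemma avg_ge0 F : (forall x, 0 <= F x) -> 0 <= avg F.
Proof. by move=> F0; rewrite divr_ge0 ?ler0n ?sumr_ge0. Qed.

Lemma avg_cst (x0 : T) (c : R) : avg (fun _ : T => c) = c.
Proof.
have T0 : #|T|%:R != 0 :> R by rewrite pnatr_eq0 -lt0n; apply/card_gt0P; exists x0.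
by rewrite /avg sumr_const -[c *+ _]mulr_natr mulfK.
Qed.

Lemma avg_CauchySchwarz F G :
  avg (fun x => F x * G x) ^+ 2
    <= avg (fun x => F x ^+ 2) * avg (fun x => G x ^+ 2).
Proof.
set a := avg (fun x => F x ^+ 2); set b := avg (fun x => F x * G x).
set c := avg (fun x => G x ^+ 2).
have quad s t : 0 <= s ^+ 2 * a + (s * t *+ 2 * b + t ^+ 2 * c).
  rewrite -!avgZ -!avgD; apply: avg_ge0 => x.
  suff -> : s ^+ 2 * F x ^+ 2 + (s * t *+ 2 * (F x * G x) + t ^+ 2 * G x ^+ 2)
    = (s * F x + t * G x) ^+ 2 by exact: sqr_ge0.
  by rewrite mulr2n; ring.
have a0 : 0 <= a by apply: avg_ge0 => x; exact: sqr_ge0.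
have [a_gt0|] := ltrP 0 a.
  (* At [(b, - a)] the quadratic form equals [a * (a * c - b ^+ 2)]. *)
  have := quad b (- a); rewrite mulr2n => q.
  have {}q : 0 <= a * (a * c - b ^+ 2) by move: q; congr (_ <= _); ring.
  by rewrite pmulr_rge0 // subr_ge0 in q.
move=> a_le0; have a00 : a = 0 by lra.
(* With [a = 0] this point gives [- (b ^+ 2 * (c + 2))], which forces [b ^+ 2 <= 0]. *)
have := quad (- (c + 1)) b; rewrite a00 mulr2n.
have c0 : 0 <= c by apply: avg_ge0 => x; exact: sqr_ge0.
move=> q; have {}q : 0 <= - (b ^+ 2 * (c + 2)).
  by move: q; congr (_ <= _); ring.
by move: q; rewrite oppr_ge0 pmulr_lle0 //; lra.
Qed.

End Average.

Lemma avg_exchange (R : realFieldType) (S T : finType) (F : S -> T -> R) :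
  avg (fun x => avg (F x)) = avg (fun y => avg (fun x => F x y)).
Proof. by rewrite /avg -!mulr_suml exchange_big /= -!mulrA [X in _ * X]mulrC. Qed.

(** If [C] is a right inverse of [A], translating [M] by [C *m N] translates [A *m M] by [N]; hence
    [A *m M] is uniform when [M] is. *)
Lemma avg_mul_row_free (R : realFieldType) (a b n : nat) (A : 'M['F_2]_(a, b))
    (F : 'M['F_2]_(a, n) -> R) :
  row_free A -> avg (fun M : 'M['F_2]_(b, n) => F (A *m M)) = avg F.
Proof.
move=> /row_freeP[C AC].
rewrite -(avg_cst (0 : 'M['F_2]_(a, n)) (avg _)).
have -> : avg F = avg (fun M : 'M['F_2]_(b, n) => avg (fun N => F (A *m M + N))).
  rewrite -[LHS](avg_cst (0 : 'M['F_2]_(b, n))); apply: eq_avg => M.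
  by rewrite /avg (reindex_inj (addrI (A *m M))).
transitivity (avg (fun N => avg (fun M : 'M['F_2]_(b, n) => F (A *m M + N)))).
  apply: eq_avg => N; rewrite /avg (reindex_inj (addIr (C *m N))) /=.
  by congr (_ / _); apply: eq_bigr => M _; rewrite mulmxDr mulmxA AC mul1mx.
exact: avg_exchange.
Qed.

(** * Fourier analysis over F_2 *)

Lemma addmx_F2 (a b : nat) (M : 'M['F_2]_(a, b)) : M + M = 0.
Proof. by apply/matrixP => i j; rewrite !mxE -mulr2n -mulr_natr pchar_Zp ?mulr0. Qed.

Lemma matrix_neq0 (K : nmodType) (a b : nat) (M : 'M[K]_(a, b)) :
  M != 0 -> exists i j, M i j != 0.
Proof.
move=> M0; have /existsP[i /existsP[j Mij]] : [exists i, exists j, M i j != 0].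
  apply: contraR M0 => /existsPn M0; apply/eqP/matrixP => i j.
  by have /existsPn/(_ j) := M0 i; rewrite negbK mxE => /eqP.
by exists i, j.
Qed.

Section Fourier.
Variables (R : realFieldType).

Definition sgnF2 (z : 'F_2) : R := if z == 0 then 1 else -1.

Lemma sgnF2D z w : sgnF2 (z + w) = sgnF2 z * sgnF2 w.
Proof.
have F2P (u : 'F_2) : (u == 0) || (u == 1) by case: u => [[|[|]]].
rewrite /sgnF2; case/orP: (F2P z) => /eqP->; case/orP: (F2P w) => /eqP->.
all: rewrite ?eqxx ?add0r ?addr0 ?mulr1 ?mul1r //=.
by rewrite mulrNN mulr1.
Qed.

Lemma sum_sgnF2 (a b : nat) (phi : 'M['F_2]_(a, b) -> 'F_2) :
  {morph phi : x y / x + y} -> (exists x, phi x != 0) ->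
  \sum_x sgnF2 (phi x) = 0.
Proof.
move=> phiD [x0 phix0]; set s := \sum_x _.
suff : s = - s by lra.
rewrite {1}/s (reindex_inj (addIr x0)) /= -sumrN; apply: eq_bigr => x _.
by rewrite phiD sgnF2D [X in _ * X]/sgnF2 (negbTE phix0) mulrN1.
Qed.

Lemma sum_sgnF2_trace (a b : nat) (M : 'M['F_2]_(a, b)) :
  \sum_(S : 'M_(b, a)) sgnF2 (\tr (S *m M))
  = (M == 0)%:R * #|{: 'M['F_2]_(b, a)}|%:R.
Proof.
have [->|M0] := eqVneq M 0.
  rewrite (eq_bigr (fun=> 1)); first by rewrite sumr_const mul1r.
  by move=> S _; rewrite mulmx0 mxtrace0 /sgnF2 eqxx.
rewrite mul0r; apply: sum_sgnF2; first by move=> x y; rewrite mulmxDl mxtraceD.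
have [i [j Mij]] := matrix_neq0 M0.
exists (delta_mx j i); rewrite mxtrace_mulC /mxtrace (bigD1 i) //= big1 ?addr0.
  by rewrite mxE (bigD1 j) //= big1 ?addr0 => [|l /negPf lj]; rewrite !mxE ?eqxx ?mulr1 ?lj ?mulr0.
by move=> l /negPf li; rewrite mxE big1 // => ? _; rewrite !mxE li andbF mulr0.
Qed.

Section Parseval.
Variables (a n : nat) (v : 'M['F_2]_(a, n) -> R).

(** The characters of the matrix group are [sgnF2 (\tr (S *m M))] as functions of [M]; the
    coefficients are unnormalised. *)
Definition fourier (S : 'M['F_2]_(n, a)) : R :=
  \sum_M v M * sgnF2 (\tr (S *m M)).

(** Once the square is expanded, orthogonality of characters keeps only the pairs with
    [N = M + D]. *)
Lemma sum_sqr_fourier_sgn (D : 'M['F_2]_(a, n)) :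
  \sum_S fourier S ^+ 2 * sgnF2 (\tr (S *m D))
  = #|{: 'M['F_2]_(n, a)}|%:R * \sum_M v M * v (M + D).
Proof.
have expand S : fourier S ^+ 2 * sgnF2 (\tr (S *m D))
    = \sum_M \sum_N v M * v N * sgnF2 (\tr (S *m (M + N + D))).
  rewrite expr2 {1}/fourier mulr_suml mulr_suml; apply: eq_bigr => M _.
  rewrite /fourier mulr_sumr mulr_suml; apply: eq_bigr => N _.
  by rewrite !mulmxDr !mxtraceD !sgnF2D; ring.
rewrite (eq_bigr _ (fun S _ => expand S)) exchange_big mulr_sumr /=.
apply: eq_bigr => M _; rewrite exchange_big /= (bigD1 (M + D)) //=.
rewrite -mulr_sumr sum_sgnF2_trace -(addrA M) -(addrA M D) !addmx_F2 addr0.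
rewrite addmx_F2 eqxx mul1r big1 ?addr0 => [|N NMD]; first by rewrite mulrC.
rewrite -mulr_sumr sum_sgnF2_trace; case: eqP => [MND|]; last by rewrite mul0r mulr0.
case/eqP: NMD; rewrite -[RHS]add0r -MND addrACA addmx_F2 addr0 addrAC.
by rewrite addmx_F2 add0r.
Qed.

Lemma sum_sqr_fourier :
  \sum_S fourier S ^+ 2 = #|{: 'M['F_2]_(n, a)}|%:R * \sum_M v M ^+ 2.
Proof.
rewrite -[LHS](eq_bigr _ (fun S _ => mulr1 _)).
transitivity (\sum_S fourier S ^+ 2 * sgnF2 (\tr (S *m 0))).
  by apply: eq_bigr => S _; rewrite mulmx0 mxtrace0 /sgnF2 eqxx.
rewrite sum_sqr_fourier_sgn; congr (_ * _); apply: eq_bigr => M _.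
by rewrite addr0 expr2.
Qed.

Lemma fourier0 : fourier 0 = \sum_M v M.
Proof. by apply: eq_bigr => M _; rewrite mul0mx mxtrace0 /sgnF2 eqxx mulr1. Qed.

End Parseval.

(** The sum over [x] keeps only the [y] in the kernel of [S], which are at most half of all columns
    when [S != 0]. *)
Lemma sum_sgnF2_rank_one (a n : nat) (S : 'M['F_2]_(n, a)) :
  \sum_(y : 'cV_a) \sum_(x : 'rV_n) sgnF2 (\tr (S *m (y *m x)))
  <= (#|{: 'cV['F_2]_a}| * #|{: 'rV['F_2]_n}|)%:R * (1 + (S == 0)%:R) / 2.
Proof.
have inner (y : 'cV_a) : \sum_(x : 'rV_n) sgnF2 (\tr (S *m (y *m x)))
    = (S *m y == 0)%:R * #|{: 'rV['F_2]_n}|%:R.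
  rewrite -sum_sgnF2_trace; apply: eq_bigr => x _.
  by rewrite mulmxA mxtrace_mulC.
rewrite (eq_bigr _ (fun y _ => inner y)) -mulr_suml natrM -!mulrA [X in _ <= _ * X]mulrC.
rewrite !mulrA ler_wpM2r ?ler0n //.
have [->|S0] := eqVneq S 0.
  rewrite (eq_bigr (fun=> 1)) => [|y _]; last by rewrite mul0mx eqxx.
  by rewrite sumr_const ?eqxx /=; lra.
have [i [j Sij]] := matrix_neq0 S0.
pose d : 'cV['F_2]_a := delta_mx j 0.
have Sj0 : S *m d != 0.
  by rewrite /d -colE; apply: contraNneq Sij => /matrixP/(_ i 0); rewrite !mxE => ->.
set s := \sum_y _; have sE : s = \sum_y (S *m (y + d) == 0)%:R.
  by rewrite /s (reindex_inj (addIr d)).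
(* As [S *m d != 0], at most one of [y] and [y + d] lies in the kernel. *)
suff : s + s <= #|{: 'cV['F_2]_a}|%:R by rewrite /=; lra.
rewrite {2}sE /s -big_split /= -sumr_const ler_sum // => y _.
rewrite mulmxDr; have [->|_] := eqVneq (S *m y) 0; last by rewrite add0r; case: eqP.
by rewrite add0r (negPf Sj0) addr0.
Qed.

(** In the Fourier expansion [S] gets weight at most [(1 + (S == 0)%:R) / 2]: the part supported at
    [S = 0] yields [avg v ^+ 2], the constant part is Parseval. *)
Lemma avg_rank_one_shift (a n : nat) (v : 'M['F_2]_(a, n) -> R) :
  avg (fun y : 'cV_a => avg (fun x : 'rV_n => avg (fun M => v M * v (M + y *m x))))
  <= (avg v ^+ 2 + avg (fun M => v M ^+ 2)) / 2.
Proof.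
pose g := #|{: 'M['F_2]_(a, n)}|%:R : R.
have gE : #|{: 'M['F_2]_(n, a)}|%:R = g by rewrite /g !card_mx mulnC.
have g0 : 0 < g by rewrite ltr0n; apply/card_gt0P; exists 0.
pose Y := #|{: 'cV['F_2]_a}|%:R : R; pose X := #|{: 'rV['F_2]_n}|%:R : R.
have Y0 : 0 < Y by rewrite ltr0n; apply/card_gt0P; exists 0.
have X0 : 0 < X by rewrite ltr0n; apply/card_gt0P; exists 0.
pose W := \sum_(y : 'cV_a) \sum_(x : 'rV_n) \sum_M v M * v (M + y *m x).
have -> : avg (fun y : 'cV_a => avg (fun x : 'rV_n =>
    avg (fun M => v M * v (M + y *m x)))) = W / (Y * X * g).
  rewrite {1}/avg -/Y /W !mulr_suml; apply: eq_bigr => y _.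
  rewrite /avg -/X -/g !mulr_suml; apply: eq_bigr => x _.
  by rewrite !invfM; ring.
have -> : avg v ^+ 2 = fourier v 0 ^+ 2 / g ^+ 2 by rewrite fourier0 -expr_div_n.
have -> : avg (fun M => v M ^+ 2) = (\sum_S fourier v S ^+ 2) / g ^+ 2.
  by rewrite sum_sqr_fourier gE /avg -/g; field; lra.
have -> : W = (\sum_S fourier v S ^+ 2
    * \sum_(y : 'cV_a) \sum_(x : 'rV_n) sgnF2 (\tr (S *m (y *m x)))) / g.
  apply: (canRL (mulfK (lt0r_neq0 g0))).
  rewrite mulrC /W mulr_sumr [RHS](eq_bigr _ (fun S _ => mulr_sumr _ _ _ _)) exchange_big.
  apply: eq_bigr => y _; rewrite mulr_sumr.
  rewrite [RHS](eq_bigr _ (fun S _ => mulr_sumr _ _ _ _)) exchange_big.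
  by apply: eq_bigr => x _; rewrite sum_sqr_fourier_sgn gE.
have -> : fourier v 0 ^+ 2 = \sum_S fourier v S ^+ 2 * (S == 0)%:R.
  rewrite (bigD1 0) //= eqxx mulr1 big1 ?addr0 // => S /negPf->.
  by rewrite mulr0.
rewrite -mulrDl -big_split /= !mulr_suml ler_sum // => S _.
have := sum_sgnF2_rank_one S; rewrite natrM -/X -/Y => le_S.
have -> : (fourier v S ^+ 2 * (S == 0)%:R + fourier v S ^+ 2) / g ^+ 2 / 2
   = fourier v S ^+ 2 * (Y * X * (1 + (S == 0)%:R) / 2) / (Y * X * g ^+ 2).
  by field; rewrite !gt_eqF.
have -> : forall z : R, z / g / (Y * X * g) = z / (Y * X * g ^+ 2).
  by move=> z; field; rewrite !gt_eqF.
apply: ler_wpM2r; first by rewrite invr_ge0 ltW // !mulr_gt0 // exprn_gt0.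
by rewrite ler_wpM2l ?sqr_ge0.
Qed.

End Fourier.

(** * The threshold inequality *)

Definition rowspace (k n : nat) (M : 'M['F_2]_(k, n)) : {set vecF2 n} :=
  [set v : vecF2 n | (v <= M)%MS].

Lemma rowspace_subspace (k n : nat) (M : 'M['F_2]_(k, n)) :
  is_subspace (rowspace M).
Proof.
apply/andP; split; first by rewrite inE sub0mx.
apply/forall_inP => x; rewrite inE => xM; apply/forall_inP => y; rewrite inE => yM.
by apply/forallP => c; rewrite inE addmx_sub ?scalemx_sub.
Qed.

Lemma rowspace_sub (j k n : nat) (M : 'M['F_2]_(j, n)) (N : 'M['F_2]_(k, n)) :
  (M <= N)%MS -> rowspace M \subset rowspace N.
Proof. by move=> MN; apply/subsetP => v; rewrite !inE => /submx_trans; exact. Qed.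

Lemma ideal_rowspace (n : nat) (Q : {set {set vecF2 n}}) (j k : nat)
    (M : 'M['F_2]_(j, n)) (N : 'M['F_2]_(k, n)) :
  is_ideal Q -> (M <= N)%MS -> rowspace N \in Q -> rowspace M \in Q.
Proof.
move=> /andP[_ /forall_inP idQ] MN /idQ /forallP/(_ (rowspace M)) /implyP.
by apply; rewrite rowspace_subspace rowspace_sub.
Qed.

Definition density (R : realFieldType) (n : nat) (Q : {set {set vecF2 n}})
    (k : nat) : R :=
  avg (fun M : 'M['F_2]_(k, n) => (rowspace M \in Q)%:R).

Section Threshold.
Variables (R : realFieldType) (n : nat) (Q : {set {set vecF2 n}}).
Hypothesis idQ : is_ideal Q.
Local Notation p := (density R Q).

Lemma density_ge0 k : 0 <= p k.
Proof. by apply: avg_ge0 => M; rewrite ler0n. Qed.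

Lemma density_le1 k : p k <= 1.
Proof.
rewrite -[leRHS](avg_cst (0 : 'M['F_2]_(k, n))); apply: ler_avg => M.
by rewrite lern1 leq_b1.
Qed.

Lemma avg_shift_ge (k : nat) (y : 'cV['F_2]_k.+1) : y != 0 ->
  p k.+1 ^+ 2 <= p k * avg (fun x : 'rV['F_2]_n => avg (fun M =>
    (rowspace M \in Q)%:R * (rowspace (M + y *m x) \in Q)%:R)).
Proof.
move=> y0.
(* K *m M spans the combinations of rows of M that adding y *m x does not change. *)
pose K := row_base (kermx y).
have /sub_kermxP Ky : (K <= kermx y)%MS by rewrite eq_row_base.
have rkK : \rank (kermx y) = k.
  rewrite mxrank_ker; suff -> : \rank y = 1%N by rewrite subn1.
  by apply/eqP; rewrite eqn_leq rank_leq_col lt0n mxrank_eq0.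
have -> : p k = avg (fun M : 'M['F_2]_(k.+1, n) => (rowspace (K *m M) \in Q)%:R ^+ 2).
  rewrite -[in LHS]rkK /density -(avg_mul_row_free _ (row_base_free (kermx y))).
  by apply: eq_avg => M; rewrite -natrX -mulnn mulnb andbb.
(* [T] averages the indicator over the coset of [M] under the shifts [y *m x]; against a function
   constant on these cosets, it can be replaced by the indicator itself. *)
pose T M := avg (fun x : 'rV['F_2]_n => (rowspace (M + y *m x) \in Q)%:R) : R.
have avgT (g : _ -> R) :
   (forall (M : 'M['F_2]_(k.+1, n)) x, g (M + y *m x) = g M) ->
   avg (fun M => g M * T M) = avg (fun M => g M * (rowspace M \in Q)%:R).
  move=> g_inv; transitivity (avg (fun x : 'rV['F_2]_n => avg (fun M : 'M['F_2]_(k.+1, n) =>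
      g M * (rowspace (M + y *m x) \in Q)%:R))).
    by rewrite avg_exchange; apply: eq_avg => M; rewrite /T avgZ.
  rewrite -[RHS](avg_cst (0 : 'rV['F_2]_n)); apply: eq_avg => x.
  rewrite [in RHS]/avg (reindex_inj (addIr (y *m x))) /=.
  by congr (_ / _); apply: eq_bigr => M _; rewrite g_inv.
have -> : avg (fun x : 'rV['F_2]_n => avg (fun M =>
    (rowspace M \in Q)%:R * (rowspace (M + y *m x) \in Q)%:R)) = avg (fun M => T M ^+ 2).
  rewrite avg_exchange; transitivity (avg (fun M => T M * (rowspace M \in Q)%:R)).
    by apply: eq_avg => M; rewrite avgZ mulrC.
  (* [T] is itself constant on the cosets. *)
  rewrite -avgT // => M x; rewrite /T /avg (reindex_inj (addIr x)) /=.
  congr (_ / _); apply: eq_bigr => z _.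
  by rewrite mulmxDr [y *m z + _]addrC addrA -(addrA M) addmx_F2 addr0.
apply: le_trans (avg_CauchySchwarz _ _).
rewrite avgT => [|M x]; last by rewrite mulmxDr mulmxA Ky mul0mx addr0.
suff -> : p k.+1 = avg (fun M : 'M['F_2]_(k.+1, n) =>
   (rowspace (K *m M) \in Q)%:R * (rowspace M \in Q)%:R) by [].
(* By downward closure the first factor is 1 whenever the second is. *)
apply: eq_avg => M; case MQ: (rowspace M \in Q); last by rewrite mulr0.
by rewrite (ideal_rowspace idQ _ MQ) ?mulr1 // submxMl.
Qed.

Lemma density_step (k : nat) : p k.+1 * (2 - p k) <= p k.
Proof.
set mu := p k; set nu := p k.+1.
have := avg_rank_one_shift (fun M : 'M['F_2]_(k.+1, n) => (rowspace M \in Q)%:R : R).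
rewrite -/(density R Q k.+1) -/nu.
have -> : avg (fun M : 'M['F_2]_(k.+1, n) => (rowspace M \in Q)%:R ^+ 2) = nu.
  by apply: eq_avg => M; rewrite -natrX -mulnn mulnb andbb.
(* The column [y = 0] is split off, since [avg_shift_ge] covers only [y != 0]. *)
set Phi := (fun y : 'cV_k.+1 => _); rewrite {1}/avg (bigD1 0) //=.
have mu0 : 0 <= mu := density_ge0 k.
have nu0 : 0 <= nu := density_ge0 k.+1.
have nu1 : nu <= 1 := density_le1 k.+1.
have -> : Phi 0 = nu.
  rewrite /Phi -[RHS](avg_cst (0 : 'rV['F_2]_n)); apply: eq_avg => x.
  by apply: eq_avg => M; rewrite mul0mx addr0 -natrM mulnb andbb.
pose N := (2 ^ k)%:R : R.
have N1 : 1 <= N by rewrite ler1n expn_gt0.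
have -> : #|{: 'cV['F_2]_k.+1}|%:R = 2 * N.
  by rewrite card_mx card_Fp // muln1 expnS natrM.
set S := \sum_(y | _) _ => le1.
have le2 : (2 * N - 1) * nu ^+ 2 <= mu * S.
  rewrite mulr_sumr; apply: le_trans (ler_sum _ (fun y y0 => avg_shift_ge y0)).
  rewrite sumr_const -[_ *+ #|_|]mulr_natl ler_wpM2r ?sqr_ge0 //.
  have := cardC1 (0 : 'cV['F_2]_k.+1); rewrite card_mx card_Fp // muln1 => cC.
  rewrite (eq_card (B := predC1 (0 : 'cV['F_2]_k.+1))) // cC expnS.
  by rewrite -subn1 natrB ?muln_gt0 ?expn_gt0 // natrM.
have {}le1 : nu + S <= N * (nu ^+ 2 + nu).
  by move: le1; rewrite ler_pdivrMr; nra.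
have {}le2 : nu * ((2 * N - 1) * nu) <= nu * (mu * (N * (nu + 1) - 1)) by nra.
have [nu_gt0|] := ltrP 0 nu; last first.
  by move=> nu_le0; have -> : nu = 0 by [lra]; rewrite mul0r.
rewrite ler_pM2l // in le2.
(* Twice [le2] bounds the left side by [mu * (nu - 1)]. *)
have : (2 * N - 1) * (nu * (2 - mu) - mu) <= 0.
  by nra.
by rewrite pmulr_rle0; lra.
Qed.

End Threshold.

(** * Exponential decay away from a threshold level *)

Local Notation dist j t := ((j - t) + (t - j))%N.

Section SharpThreshold.
Variables (R : realFieldType) (p : nat -> R).
Hypotheses (p_ge0 : forall k, 0 <= p k) (p_le1 : forall k, p k <= 1).
Hypothesis p_step : forall k, p k.+1 * (2 - p k) <= p k.

(** The odds [(1 - p) / p] start at 1 or more and at least double at each level, so they reach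
    [2 ^+ j]; the statement avoids the division. *)
Lemma decay_above (k j : nat) : p k <= 2^-1 -> p (k + j)%N * (1 + 2 ^+ j) <= 1.
Proof.
move=> pk; elim: j => [|j IHj]; first by rewrite addn0 expr0; lra.
rewrite addnS exprS; have := p_step (k + j); have := p_ge0 (k + j).
have := p_ge0 (k + j).+1; have : 1 <= 2 ^+ j :> R by rewrite exprn_ege1 ?ler1n.
move: IHj; move: (p _) (p _.+1) (2 ^+ j) => a b e h1 h2 h3 h4 h5.
have ha : 0 < 2 - a by nra.
rewrite -(ler_pM2l ha); nra.
Qed.

(** Going down, the inverse odds [p / (1 - p)] at least double at each level. *)
Lemma decay_below (k j : nat) : 2^-1 <= p (k + j)%N -> (1 - p k) * (1 + 2 ^+ j) <= 1.
Proof.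
elim: j k => [|j IHj] k; first by rewrite addn0 expr0; lra.
rewrite addnS -addSn => /IHj {}IHj; have := p_step k.
rewrite exprS; have : 1 <= 2 ^+ j :> R by rewrite exprn_ege1 ?ler1n.
have := p_le1 k; have := p_ge0 k; have := p_le1 k.+1; have := p_ge0 k.+1.
move: IHj; move: (p _) (p _.+1) (2 ^+ j) => a b e.
move=> h1 h2 h3 h4 h5 h6 h7; nra.
Qed.

Lemma sharp_threshold (K : nat) : exists t : nat, forall j, (j < K)%N ->
  (if (t <= j)%N then p j.+1 else 1 - p j.+1) <= 2 * 2^-1 ^+ dist j t.
Proof.
(* The index [j] stands for level [j.+1]. The threshold is the first index with density below 1/2,
   or [K] if there is none. *)
pose a j := p j.+1 < 2^-1; exists (find a (iota 0 K)) => j jK.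
set t := find _ _; have [tj|jt] := leqP t j.
  have tK : (t < size (iota 0 K))%N by rewrite size_iota (leq_ltn_trans tj).
  have : a (nth 0%N (iota 0 K) t) by rewrite nth_find // has_find.
  rewrite size_iota in tK; rewrite nth_iota // add0n => /ltW /(decay_above (j - t)%N).
  have -> : (t - j = 0)%N by lia.
  have -> : (t.+1 + (j - t) = j.+1)%N by lia.
  rewrite addn0 exprVn => h.
  have e1 : 1 <= 2 ^+ (j - t) :> R by rewrite exprn_ege1 ?ler1n.
  by rewrite ler_pdivlMr ?exprn_gt0 ?ltr0n //; have := p_ge0 j.+1; nra.
have tK : (t <= K)%N by rewrite -[leqRHS](size_iota 0) find_size.
have : ~~ a t.-1.
  have := @before_find _ 0%N a (iota 0 K) t.-1; rewrite nth_iota ?add0n; last by lia.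
  by move=> ->; lia.
rewrite /a -leNgt; have -> : (t.-1.+1 = j.+1 + (t - j.+1))%N by lia.
move/decay_below.
have -> : (j - t = 0)%N by lia.
(* Density at least 1/2 is known only at index [t.-1], one step nearer than [t]; the factor 2 in the
   bound pays for this. *)
have -> : (t - j = (t - j.+1).+1)%N by lia.
rewrite add0n exprVn exprS => h.
have e1 : 1 <= 2 ^+ (t - j.+1) :> R by rewrite exprn_ege1 ?ler1n.
rewrite invfM mulrA mulfV ?pnatr_eq0 // mul1r -[leRHS]mul1r ler_pdivlMr ?exprn_gt0 ?ltr0n //.
by have := p_le1 j.+1; nra.
Qed.

End SharpThreshold.

(** * Summing the decay over all levels *)

Section DistSum.
Variable (R : realFieldType).
Implicit Types (G : nat -> R).

(** The terms with [j >= t] telescope to at most [G 0], those with [j < t] to at most [G 1]. *)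
Lemma sum_dist_telescope G (K t : nat) :
  (forall c, G c.+1 <= G c) -> (forall c, 0 <= G c) ->
  \sum_(j < K) (G (dist j t) - G (dist j t).+1) <= G 0%N + G 1%N.
Proof.
(* The extra [- G t.+1] drives the induction: removing [j = 0] lowers the threshold by one and frees
   [G t.+1 - G t.+2]. *)
move=> Gdec G0; suff : \sum_(j < K) (G (dist j t) - G (dist j t).+1)
    <= G 0%N + G 1%N - G t.+1 by move/le_trans; apply; rewrite lerBlDr lerDl.
elim: t K => [|t IHt] K.
  rewrite addrK; suff -> : \sum_(j < K) (G (dist j 0%N) - G (dist j 0%N).+1) = G 0%N - G K.
    by rewrite lerBlDr lerDl.
  elim: K => [|K IHK]; first by rewrite big_ord0 subrr.
  by rewrite big_ord_recr /= IHK subn0 sub0n addn0 addrA subrK.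
case: K => [|K].
  rewrite big_ord0; have: G t.+2 <= G 1%N.
    by elim: t.+1 => [|c IHc]; rewrite ?lexx // (le_trans (Gdec _)).
  by have := G0 0%N; lra.
rewrite big_ord_recl /= sub0n add0n subn0; have := IHt K.
by rewrite (eq_bigr (fun j : 'I_K => G (dist j t) - G (dist j t).+1)) => [|j _] //; lra.
Qed.

Lemma sum_half_dist (K t : nat) :
  \sum_(j < K) (2^-1 : R) ^+ dist j t <= 3.
Proof.
have := @sum_dist_telescope (fun c => 2 * 2^-1 ^+ c) K t.
rewrite expr0 expr1 (eq_bigr (fun j : 'I_K => 2^-1 ^+ dist j t)) => [|j _].
  have e0 c : 0 <= 2^-1 ^+ c :> R by rewrite exprn_ge0 ?invr_ge0.
  move=> h; apply: (le_trans (h _ _)); last by lra.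
    by move=> c; rewrite exprS; have := e0 c; lra.
  by move=> c; rewrite mulr_ge0.
by rewrite exprS; lra.
Qed.

Lemma sum_dist_half_dist (K t : nat) :
  \sum_(j < K) (dist j t)%:R * (2^-1 : R) ^+ dist j t <= 4.
Proof.
(* This [G] is an antidifference: [G c - G c.+1] is [c * 2^-c], and [G 0 + G 1 = 4]. *)
have := @sum_dist_telescope (fun c => (c.+1)%:R * 2 * 2^-1 ^+ c) K t.
rewrite expr0 expr1 (eq_bigr (fun j : 'I_K => (dist j t)%:R * 2^-1 ^+ dist j t)) => [|j _].
  have e0 c : 0 <= 2^-1 ^+ c :> R by rewrite exprn_ge0 ?invr_ge0.
  move=> h; apply: (le_trans (h _ _)); last by lra.
    move=> c; rewrite /= exprS -[c.+2%:R]natr1 -[c.+1%:R]natr1.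
    by have := e0 c; have := ler0n R c; nra.
  by move=> c; rewrite !mulr_ge0.
by rewrite exprS -[(dist j t).+2%:R]natr1 -[(dist j t).+1%:R]natr1; lra.
Qed.

End DistSum.

(** * Counting answer vectors *)

Section Elementary.
Variable (R : realFieldType).

Lemma bernoulli_ineq (x : R) (s : nat) : -1 <= x -> 1 + s%:R * x <= (1 + x) ^+ s.
Proof.
move=> x1; elim: s => [|s IHs]; first by rewrite mul0r addr0.
have : 0 <= (1 + x) * ((1 + x) ^+ s - (1 + s%:R * x)).
  by rewrite mulr_ge0 ?subr_ge0 //; lra.
by rewrite exprS -natr1; have := ler0n R s; nra.
Qed.

(** The inverse of the base is [a = 1 - 1/(n+2)] after the shift of [n]; Bernoulli on half the
    exponent gives [a ^+ h >= 1/2], and squaring gives 1/4. *)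
Lemma expr_1DV_le4 (n : nat) : (1 + n%:R^-1 : R) ^+ n <= 4.
Proof.
case: n => [|n]; first by rewrite expr0; lra.
have n0 : 0 <= n%:R :> R by exact: ler0n.
pose a : R := 1 - n.+2%:R^-1.
have n2 : 0 < n.+2%:R :> R by rewrite ltr0n.
have n1 : 0 < n.+1%:R :> R by rewrite ltr0n.
have aE : a = n.+1%:R / n.+2%:R.
  apply: (canRL (mulfK (lt0r_neq0 n2))).
  by rewrite mulrBl mul1r mulVf ?lt0r_neq0 // -natr1 addrK.
have a0 : 0 < a by rewrite aE divr_gt0.
have a1 : a <= 1 by rewrite /a gerBl invr_ge0 ltW.
have -> : 1 + n.+1%:R^-1 = a^-1.
  by rewrite aE invf_div -[n.+2%:R]natr1 mulrDl mulfV ?lt0r_neq0 // mul1r.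
rewrite exprVn -[leRHS]invrK lef_pV2 ?posrE ?exprn_gt0 ?invr_gt0 //.
pose h := uphalf n.+1.
have ah : 2^-1 <= a ^+ h.
  have : -1 <= - n.+2%:R^-1 :> R.
    by rewrite lerN2 invf_le1 // ler1n.
  move=> /(bernoulli_ineq h); apply: le_trans.
  rewrite mulrN lerBrDl -lerBrDr.
  have -> : 1 - 2^-1 = 2^-1 :> R by field.
  rewrite ler_pdivrMr // mulrC ler_pdivlMr // -natrM ler_nat /h.
  by rewrite uphalfE; lia.
have : a ^+ (h + h) <= a ^+ n.+1.
  by apply: ler_wiXn2l; rewrite ?(ltW a0) // /h uphalfE; lia.
by rewrite exprD; nra.
Qed.

(** AM-GM, then [(1 + s/N)^N <= (1 + 1/N)^(sN) <= 4^s] with [N = #|I|]; this replaces the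
    exponential function. *)
Lemma prod_1D_le (I : finType) (x : I -> R) (s : nat) :
  (forall i, 0 <= x i) -> \sum_i x i <= s%:R -> \prod_i (1 + x i) <= 4 ^+ s.
Proof.
move=> x0 xs; have [I0|I_gt0] := posnP #|I|.
  rewrite big_pred0 ?exprn_ege1 ?ler1n // => i.
  by have := card0_eq I0 i; rewrite !inE.
have n0 : 0 < #|I|%:R :> R by rewrite ltr0n.
have /leif_AGM : {in I, forall i, 0 <= 1 + x i} by move=> i _; rewrite addr_ge0.
case=> /= + _; rewrite big_split /= sumr_const => /le_trans; apply.
rewrite mulrDl divff ?gt_eqF //.
apply: (@le_trans _ _ ((1 + s%:R * #|I|%:R^-1) ^+ #|I|)).
  rewrite lerXn2r ?nnegrE ?addr_ge0 ?mulr_ge0 ?invr_ge0 ?sumr_ge0 ?(ltW n0) ?ler0n //.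
  by rewrite lerD2l ler_pM2r ?invr_gt0.
apply: (@le_trans _ _ (((1 + #|I|%:R^-1) ^+ s) ^+ #|I|)).
  rewrite lerXn2r ?nnegrE ?exprn_ge0 ?addr_ge0 ?mulr_ge0 ?invr_ge0 ?(ltW n0) ?ler0n //.
  apply: bernoulli_ineq; have : 0 < #|I|%:R^-1 :> R by rewrite invr_gt0.
  by lra.
by rewrite exprAC lerXn2r ?nnegrE ?exprn_ge0 ?addr_ge0 ?invr_ge0 ?(ltW n0) ?expr_1DV_le4.
Qed.

End Elementary.

(** Union bound over the nonzero [r] with [r *m M = v]: each [r *m M] is uniform, and there are
    fewer than [2 ^ k] such [r]. *)
Lemma avg_mem_rowspace (R : realFieldType) (k n : nat) (v : vecF2 n) : v != 0 ->
  avg (fun M : 'M['F_2]_(k, n) => (v \in rowspace M)%:R) <= 2 ^+ k / 2 ^+ n :> R.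
Proof.
move=> v0; apply: (@le_trans _ _ (avg (fun M : 'M['F_2]_(k, n) =>
    \sum_(r : 'rV_k | r != 0) (r *m M == v)%:R))).
  apply: ler_avg => M; case: (boolP (v \in _)) => [|_]; last by rewrite sumr_ge0.
  rewrite inE => /submxP[r vE]; have r0 : r != 0.
    by apply: contraNneq v0 => r0; rewrite vE r0 mul0mx.
  by rewrite (bigD1 r) //= vE eqxx lerDl sumr_ge0.
rewrite avg_sum.
have each (r : 'rV['F_2]_k) : r != 0 ->
    avg (fun M : 'M['F_2]_(k, n) => (r *m M == v)%:R) = (2 ^+ n)^-1 :> R.
  move=> r0; rewrite (avg_mul_row_free (fun N => (N == v)%:R)); last first.
    by rewrite /row_free eqn_leq rank_leq_row lt0n mxrank_eq0.
  rewrite /avg (bigD1 v) //= eqxx big1 => [|N /negPf->] //.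
  by rewrite addr0 card_mx card_Fp // mul1n mul1r natrX.
rewrite (eq_bigr _ each) sumr_const -[_ *+ _]mulr_natl ler_wpM2r ?invr_ge0 ?exprn_ge0 //.
by rewrite -natrX ler_nat (leq_trans (max_card _)) // card_mx card_Fp ?mul1n.
Qed.

(** * Success rate against a fixed tuple of ideals *)

Definition answers (n m : nat) (q : tupleT n m) (A : {set vecF2 n}) :
  {ffun 'I_m -> bool} := [ffun i => A \in q i].

Definition hit_rate (R : realFieldType) (n m : nat) (q : tupleT n m)
    (f : {ffun 'I_m -> bool} -> vecF2 n) (k : nat) : R :=
  avg (fun M : 'M['F_2]_(k, n) =>
    (f (answers q (rowspace M)) \in rowspace M)%:R).

Section HitRate.
Variables (R : realFieldType) (n m : nat) (q : tupleT n m).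
Variable (f : {ffun 'I_m -> bool} -> vecF2 n).
Hypothesis f0 : forall b, f b != 0.

Lemma sum_expr_cost (b0 : 'I_m -> bool) (c : 'I_m -> nat) :
  \sum_(b : {ffun 'I_m -> bool}) (2^-1 : R) ^+ (\sum_i (b i != b0 i) * c i)
  = \prod_i (1 + 2^-1 ^+ c i).
Proof.
rewrite [RHS](eq_bigr (fun i => \sum_(u : bool) 2^-1 ^+ ((u != b0 i) * c i))).
  rewrite bigA_distr_bigA; apply: eq_bigr => b _.
  by rewrite (big_morph _ (exprD _) (expr0 _)).
by move=> i _; rewrite big_bool; case: (b0 i); rewrite ?mul0n ?mul1n ?expr0 // addrC.
Qed.

(** Markov's inequality handles answer vectors of cost at least [L]; a union bound over the guesses
    [f b] handles the cheaper ones. *)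
Lemma hit_rate_le (k L : nat) (b0 : 'I_m -> bool) (c : 'I_m -> nat) : (0 < L)%N ->
  hit_rate R q f k <=
    (\sum_i (c i)%:R * avg (fun M : 'M['F_2]_(k, n) =>
        ((rowspace M \in q i) != b0 i)%:R)) / L%:R
    + 2 ^+ L * \prod_i (1 + 2^-1 ^+ c i) * (2 ^+ k / 2 ^+ n).
Proof.
move=> L0; pose cost (b : {ffun 'I_m -> bool}) := (\sum_i (b i != b0 i) * c i)%N.
have LR : 0 < L%:R :> R by rewrite ltr0n.
apply: (@le_trans _ _ (avg (fun M : 'M['F_2]_(k, n) =>
   L%:R^-1 * (\sum_i (c i)%:R * ((rowspace M \in q i) != b0 i)%:R)
   + \sum_(b | (cost b < L)%N) (f b \in rowspace M)%:R))).
  apply: ler_avg => M; set b := answers q _.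
  have -> : \sum_i (c i)%:R * ((rowspace M \in q i) != b0 i)%:R = (cost b)%:R :> R.
    rewrite natr_sum; apply: eq_bigr => i _.
    by rewrite ffunE natrM mulrC.
  have [bL|Lb] := ltnP (cost b) L.
    rewrite (bigD1 b) //= addrCA lerDl addr_ge0 ?sumr_ge0 //.
    by rewrite mulr_ge0 ?invr_ge0 ?ler0n.
  apply: (@le_trans _ _ 1); first by rewrite lern1 leq_b1.
  rewrite -[leLHS]addr0 lerD ?sumr_ge0 //.
  by rewrite mulrC ler_pdivlMr // mul1r ler_nat.
rewrite avgD avgZ !avg_sum [X in _ <= X + _]mulrC; apply: lerD.
  by rewrite ler_wpM2l ?invr_ge0 ?ler0n // ler_sum // => i _; rewrite avgZ.
apply: (@le_trans _ _ (\sum_(b | (cost b < L)%N) (2 ^+ k / 2 ^+ n))).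
  by apply: ler_sum => b _; exact: avg_mem_rowspace.
have e0 : 0 <= 2 ^+ k / 2 ^+ n :> R by rewrite divr_ge0 ?exprn_ge0.
(* A vector of cost below [L] has weight at least [2^-L] in [sum_expr_cost], which bounds their
   number. *)
rewrite sumr_const -[_ *+ _]mulr_natl ler_wpM2r // -(sum_expr_cost b0) -sum1_card natr_sum.
rewrite mulr_sumr [leRHS](bigID (fun b => cost b < L)%N) /= -[leLHS]addr0 lerD //; last first.
  by apply: sumr_ge0 => b _; rewrite mulr_ge0 ?exprn_ge0 ?invr_ge0.
apply: ler_sum => b bL; rewrite exprVn ler_pdivlMr ?exprn_gt0 // mul1r.
by rewrite ler_eXn2l ?ltr1n // ltnW.
Qed.

Hypothesis idq : forall i, is_ideal (q i).

Lemma sum_hit_rate_le (l : nat) : (4 <= l)%N -> (8 * l <= n)%N ->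
  \sum_(j < 4 * l) hit_rate R q f j.+1 <= 11 * m%:R / l%:R + l%:R / 4.
Proof.
move=> l4 ln; pose K := (4 * l)%N.
have thr (i : 'I_m) : exists t : nat, [forall j : 'I_K,
  (if (t <= j)%N then density R (q i) j.+1 else 1 - density R (q i) j.+1)
    <= 2 * 2^-1 ^+ dist j t].
  have [t ht] := sharp_threshold (@density_ge0 R n (q i)) (@density_le1 R n (q i))
    (density_step R (idq i)) K.
  by exists t; apply/forallP => j; exact: ht.
pose t i := xchoose (thr i).
have tP i (j : 'I_K) := forallP (xchooseP (thr i)) j; rewrite -/(t _) in tP.
pose S j : R := \sum_i 2^-1 ^+ dist j (t i).
pose D j : R := \sum_i (dist j (t i))%:R * 2^-1 ^+ dist j (t i).
have l0 : 0 < l%:R :> R by rewrite ltr0n; lia.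
have S0 j : 0 <= S j by apply: sumr_ge0 => i _; rewrite exprn_ge0 ?invr_ge0.
have D0 j : 0 <= D j by apply: sumr_ge0 => i _; rewrite mulr_ge0 ?exprn_ge0 ?invr_ge0.
have hit_le1 k : hit_rate R q f k <= 1.
  rewrite -[leRHS](avg_cst (0 : 'M['F_2]_(k, n))); apply: ler_avg => M.
  by rewrite lern1 leq_b1.
have each (j : 'I_K) : hit_rate R q f j.+1 <= (2 * D j + S j) / l%:R + 16^-1.
  (* If [S j] exceeds [l], the bound is above 1 and trivial; otherwise the product in [hit_rate_le]
     is at most [4 ^+ l]. *)
  have [Sl|] := ltrP l%:R (S j).
    apply: le_trans (hit_le1 _) _; rewrite -[leLHS]addr0 lerD ?invr_ge0 //.
    by rewrite ler_pdivlMr //; have := D0 j; lra.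
  (* The reference answer for query [i] is yes exactly below its threshold [t i]. *)
  move=> Sl; apply: le_trans (hit_rate_le (L := l) j.+1 (fun i => j < t i)%N
    (fun i => dist j (t i)) _) _; first by lia.
  apply: lerD.
    rewrite ler_pM2r ?invr_gt0 //; apply: (@le_trans _ _ (2 * D j)); last by have := S0 j; lra.
    rewrite mulr_sumr; apply: ler_sum => i _; rewrite [leRHS]mulrCA ler_wpM2l ?ler0n //.
    apply: le_trans (tP i j); rewrite /= ltnNge; case: (t i <= j)%N.
      by apply: ler_avg => M; case: (_ \in _).
    rewrite -[X in _ <= X - _](avg_cst (0 : 'M['F_2]_(j.+1, n))) -mulN1r -avgZ -avgD.
    by apply: ler_avg => M; case: (_ \in _); rewrite /= ?mulr1 ?mulr0 ?addrN ?addr0.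
  have Pl : \prod_i (1 + 2^-1 ^+ dist j (t i)) <= 2 ^+ (2 * l) :> R.
    rewrite exprM -natrX; apply: prod_1D_le => // i.
    by rewrite exprn_ge0 ?invr_ge0.
  apply: (@le_trans _ _ (2 ^+ l * 2 ^+ (2 * l) * (2 ^+ K / 2 ^+ n))).
    have two0 a : 0 <= 2 ^+ a :> R by rewrite exprn_ge0.
    apply: ler_pM; rewrite ?mulr_ge0 ?invr_ge0 //.
    - by apply: prodr_ge0 => i _; rewrite addr_ge0 ?exprn_ge0 ?invr_ge0.
    - by rewrite ler_wpM2l.
    by rewrite ler_wpM2r ?invr_ge0 // ler_eXn2l ?ltr1n.
  rewrite mulrA -!exprD ler_pdivrMr ?exprn_gt0 // ler_pdivlMl //.
  have -> : 16 = 2 ^+ 4 :> R by rewrite -natrX.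
  (* The exponents are [l + 2l + 4l = 7l] against [n >= 8l], and [l >= 4] leaves the factor 1/16. *)
  by rewrite -exprD ler_eXn2l ?ltr1n // /K; lia.
apply: (le_trans (ler_sum _ (fun j _ => each j))); rewrite big_split /= -mulr_suml big_split /=.
apply: lerD.
  rewrite ler_pM2r ?invr_gt0 // -mulr_sumr.
  have : \sum_(j < K) D j <= 4 * m%:R.
    rewrite exchange_big /=.
    apply: (le_trans (ler_sum _ (fun i _ => sum_dist_half_dist R K (t i)))).
    by rewrite sumr_const card_ord mulr_natr.
  have : \sum_(j < K) S j <= 3 * m%:R.
    rewrite exchange_big /=.
    apply: (le_trans (ler_sum _ (fun i _ => sum_half_dist R K (t i)))).
    by rewrite sumr_const card_ord mulr_natr.
  by lra.
by rewrite sumr_const card_ord -[leLHS]mulr_natr natrM; lra.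
Qed.

End HitRate.

(** * Averaging over the random tuple and conclusion *)

Lemma sum_mu_hit_rate_ge (R : realFieldType) (n m : nat) (mu : tupleT n m -> R)
    (f : {ffun 'I_m -> bool} -> vecF2 n) (k : nat) :
  (1 < n)%N ->
  (forall q, 0 <= mu q) ->
  (forall A, is_subspace A -> A != [set 0] -> 2^-1 <= prob_hit mu f A) ->
  3 / 8 <= \sum_q mu q * hit_rate R q f k.+1.
Proof.
move=> n1 mu0 hit.
have -> : \sum_q mu q * hit_rate R q f k.+1
    = avg (fun M : 'M['F_2]_(k.+1, n) => prob_hit mu f (rowspace M)).
  rewrite /prob_hit (eq_bigr _ (fun q _ => esym (avgZ _ _))) -avg_sum.
  apply: eq_avg => M; rewrite [RHS]big_mkcond; apply: eq_bigr => q _.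
  by rewrite /answers; case: ifP => _; rewrite ?mulr1 ?mulr0.
(* The hypothesis says nothing for [M = 0], an event of probability at most 1/4; hence 3/8 = 1/2 -
   1/8. *)
apply: (@le_trans _ _ (avg (fun M : 'M['F_2]_(k.+1, n) =>
    2^-1 + - 2^-1 * (M == 0)%:R))); last first.
  apply: ler_avg => M; have [->|M0] := eqVneq M 0.
    by rewrite mulr1 addrN sumr_ge0.
  rewrite mulr0 addr0 hit ?rowspace_subspace //.
  apply: contraNneq M0 => rM; apply/eqP/row_matrixP => i; rewrite row0; apply/set1P.
  by rewrite -rM inE row_sub.
rewrite avgD avgZ (avg_cst (0 : 'M['F_2]_(k.+1, n))).
have -> : avg (fun M : 'M['F_2]_(k.+1, n) => (M == 0)%:R) = (2 ^+ (k.+1 * n))^-1 :> R.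
  rewrite /avg (bigD1 0) //= eqxx big1 => [|M /negPf->] //.
  by rewrite addr0 mul1r card_mx card_Fp // natrX.
have : (2 ^+ (k.+1 * n))^-1 <= (2 ^+ 2)^-1 :> R.
  by rewrite lef_pV2 ?posrE ?exprn_gt0 // ler_eXn2l ?ltr1n //; lia.
by lra.
Qed.

Theorem theorem7 :
  exists (c : rat) (n0 : nat), 0 < c /\
    forall (R : realFieldType) (n m : nat) (mu : tupleT n m -> R)
           (f : {ffun 'I_m -> bool} -> vecF2 n),
      (1 <= n)%N -> (n0 <= n)%N ->
      is_ideal_tuple_distr mu ->
      (forall b, f b != 0) ->
      (forall A : {set vecF2 n}, is_subspace A -> A != [set 0] ->
         2^-1 <= prob_hit mu f A) ->
      c * (n ^ 2)%:R <= m%:R.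
Proof.
(* Here 2816 = 11 * 16^2, from [l * l <= 11 * m] and [n <= 16 * l]; [n >= 32] ensures [l >= 4]. *)
exists 2816%:R^-1, 32%N; split=> [|R n m mu f _ n32 [mu0 [mu1 idmu]] f0 hit].
  by rewrite invr_gt0 ltr0n.
pose l := (n %/ 8)%N; have l4 : (4 <= l)%N by rewrite /l; lia.
have ln : (8 * l <= n)%N by rewrite /l; lia.
have nl : (n <= 16 * l)%N by rewrite /l; lia.
have l0 : 0 < l%:R :> R by rewrite ltr0n; lia.
have lower : (4 * l)%:R * (3 / 8) <= \sum_q mu q * \sum_(j < 4 * l) hit_rate R q f j.+1.
  rewrite (eq_bigr _ (fun q _ => mulr_sumr _ _ _ _)) exchange_big /=.
  have n1 : (1 < n)%N by lia.
  apply: (le_trans _ (ler_sum _ (fun j _ => sum_mu_hit_rate_ge (val j) n1 mu0 hit))).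
  by rewrite sumr_const card_ord mulr_natl.
have upper : \sum_q mu q * \sum_(j < 4 * l) hit_rate R q f j.+1
    <= 11 * m%:R / l%:R + l%:R / 4.
  rewrite -[leRHS]mul1r -[X in _ <= X * _]mu1 mulr_suml; apply: ler_sum => q _.
  have [->|muq] := eqVneq (mu q) 0; first by rewrite !mul0r.
  by apply: ler_wpM2l => //; apply: sum_hit_rate_le => // i; exact: idmu.
(* Comparing the bounds, [3l/2 <= 11m/l + l/4]. *)
have : (l * l <= 11 * m)%N.
  have := le_trans lower upper; rewrite -lerBlDr ler_pdivlMr // natrM => h.
  by rewrite -(ler_nat R) !natrM; nra.
move=> ll; rewrite mulrC ler_pdivrMr ?ltr0n // -natrM ler_nat; nia.
Qed.
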